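(* Let $\mathbb{R}_+=(0,+\infty)$. For an integer $r>2$, let $\varphi_r:\mathbb{R}^4_+\rightarrow \mathbb{R}^4_+$ be the map $$\varphi_r(x_1,x_2,x_3,x_4)= \left(x_3,\;x_4,\;\frac{x_2^r+x_3^r}{x_1},\; \frac{x_1^rx_4^r+ (x_2^r+x_3^r)^r}{x_1^rx_2}\right)$$ and let $\pi_r:\mathbb{R}^4_+\rightarrow \mathbb{R}^2_+$ be the map $\pi_r(x_1,x_2,x_3,x_4) =\left(\frac{x_3}{x_2},\frac{x_2^r+x_3^r}{x_1x_4}\right)$. Then: 1. $\varphi_r$ has a unique fixed point, the point $F=(2^{\frac{1}{2-r}},2^{\frac{1}{2-r}},2^{\frac{1}{2-r}},2^{\frac{1}{2-r}})$. 2. Any point in $V\setminus\{F\}$, where $$V=\left\{(x_1,x_2,x_3,x_4)\in\mathbb{R}_+^4: \; x_4=x_1, \;\; x_1^rx_2x_3=x_1^{2r}+\left(x_2^r+x_3^r\right)^r\right\},$$ is a periodic point of $\varphi_r$ with minimal period 4. 3. Any point $\mathbf{x}\in\mathbb{R}^4_+\setminus V$ is non-periodic for $\varphi_r$, and: (a) If $\mathbf{x}$ belongs to the $\varphi_r$-invariant set $$C^r_{(1,1)}=\{(x_1,x_2,x_3,x_4)\in\mathbb{R}_+^4:\; x_3=x_2,\;\; x_1x_4=2x_2^r\},$$ then the $\varphi_r$-orbit of $\mathbf{x}$ is entirely contained in the curve $$L_{\mathbf{x}}=\{\mathbf{z}\in C^r_{(1,1)}: J_a(\mathbf{z})=J_a(\mathbf{x})\},$$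 where $J_a(\mathbf{z})=(\log z_1)^2-r\log(z_1)\log(z_2)+(\log z_2)^2-\log(2)\log(z_1z_2)$. Moreover, the orbit of $\mathbf{x}$ either converges to the fixed point $F$, or converges to $(0,0,0,0)$, or else every component of $\varphi_r^{(n)}(\mathbf{x})$ goes to $+\infty$ as $n\to\infty$. (b) If $\mathbf{x}$ does not belong to $C^r_{(1,1)}$, then its $\varphi_r$-orbit circulates between the four pairwise disjoint curves $\mathcal{L}_{\mathbf{x}}$, $\mathcal{L}_{\varphi_r(\mathbf{x})}$, $\mathcal{L}_{\varphi_r^{(2)}(\mathbf{x})}$ and $\mathcal{L}_{\varphi_r^{(3)}(\mathbf{x})}$ (that is, $\varphi_r^{(4n+i)}(\mathbf{x})\in \mathcal{L}_{\varphi_r^{(i)}(\mathbf{x})}$ for all $n\ge 0$ and $i=0,1,2,3$), where $$\mathcal{L}_{\mathbf{y}}=\{\mathbf{z}\in \mathbb{R}_+^4: \pi_r(\mathbf{z})=\pi_r(\mathbf{y}), \;\; J_b(\mathbf{z})=J_b(\mathbf{y})\},$$ with $$J_b(\mathbf{z})=(\log (z_1z_4))^2-r^2\log (z_1)\log (z_4)-\log(l(\mathbf{z}))\log (z_1z_4),\qquad l(\mathbf{z})=\frac{\left(z_1^rz_4^r+(z_2^r+z_3^r)^r\right)^r}{z_1^{r^2-2}z_2^rz_3^rz_4^{r^2-2}}.$$ Moreover, the orbit of $\mathbf{x}$ either converges to the orbit of a 4-periodic point, or converges to $(0,0,0,0)$, or else every component of $\varphi_r^{(n)}(\mathbf{x})$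 goes to $+\infty$ as $n\to\infty$.
   Context: $f^{(m)}=f\circ\cdots\circ f$ ($m$ compositions) denotes the $m$-th iterate of $f$, with $f^{(0)}=\mathrm{Id}$. A point $\mathbf{x}$ is periodic for $f$ with minimal period $m\geq 1$ if $f^{(m)}(\mathbf{x})=\mathbf{x}$ and $f^{(k)}(\mathbf{x})\neq\mathbf{x}$ for all $1\le k<m$. The (forward) $f$-orbit of $\mathbf{x}$ is $\{f^{(n)}(\mathbf{x}): n\geq 0\}$; it converges to a point $\mathbf{y}$ if $f^{(n)}(\mathbf{x})\to\mathbf{y}$ as $n\to\infty$. ''The orbit of $\mathbf{x}$ converges to the orbit of a 4-periodic point'' means that there is a periodic point $\mathbf{y}$ of minimal period 4 such that $f^{(4n+i)}(\mathbf{x})\to f^{(i)}(\mathbf{y})$ as $n\to\infty$ for $i=0,1,2,3$. A set $S$ is $f$-invariant if $f(S)\subset S$. *)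

(* Defs.v *)
From mathcomp Require Import all_boot all_order all_algebra.
From mathcomp Require Import all_classical all_reals all_analysis.
Set Implicit Arguments.
Unset Strict Implicit.
Unset Printing Implicit Defensive.
Import Order.TTheory GRing.Theory Num.Theory.
Import numFieldNormedType.Exports.

Local Open Scope classical_set_scope.
Local Open Scope ring_scope.

Section Dynamics.
Variable T : Type.
Implicit Types (f : T -> T) (x : T) (S : set T).

Definition has_minimal_period f (m : nat) x : Prop :=
  [/\ (1 <= m)%N, iter m f x = x
    & forall k, (1 <= k < m)%N -> iter k f x <> x].

Definition periodic_pt f x : Prop := exists m : nat, has_minimal_period f m x.

Definition forward_invariant f S : Prop := f @` S `<=` S.

End Dynamics.

Section Maps.
Variable R : realType.
Implicit Types (x y z : R * R * R * R) (r : nat).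

Definition pos4 : set (R * R * R * R) :=
  [set x | let: (x1, x2, x3, x4) := x in
           [/\ 0 < x1, 0 < x2, 0 < x3 & 0 < x4]].

Definition pos2 : set (R * R) := [set y | 0 < y.1 /\ 0 < y.2].

(* [phi r] and [pi_ r] are total functions, because division is total, but they
   are only meaningful on [pos4]; [phi_pos4] and [pi_pos2] show that they map
   [pos4] to [pos4] and to [pos2] respectively. *)
Definition phi r x : R * R * R * R :=
  let: (x1, x2, x3, x4) := x in
  (x3, x4, (x2 ^+ r + x3 ^+ r) / x1,
   (x1 ^+ r * x4 ^+ r + (x2 ^+ r + x3 ^+ r) ^+ r) / (x1 ^+ r * x2)).

Definition pi_ r x : R * R :=
  let: (x1, x2, x3, x4) := x in (x3 / x2, (x2 ^+ r + x3 ^+ r) / (x1 * x4)).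

Lemma phi_pos4 r x : pos4 x -> pos4 (phi r x).
Proof.
case: x => [[[x1 x2] x3] x4] [x1_gt0 x2_gt0 x3_gt0 x4_gt0].
by split=> //; rewrite ?divr_gt0 ?addr_gt0 ?mulr_gt0 ?exprn_gt0 ?addr_gt0
  ?exprn_gt0.
Qed.

Lemma pi_pos2 r x : pos4 x -> pos2 (pi_ r x).
Proof.
case: x => [[[x1 x2] x3] x4] [x1_gt0 x2_gt0 x3_gt0 x4_gt0].
by split; rewrite /= ?divr_gt0 ?addr_gt0 ?mulr_gt0 ?exprn_gt0.
Qed.

Definition F_ r : R * R * R * R :=
  let a := 2 `^ ((2 - r%:R)^-1) in (a, a, a, a).

Definition V_ r : set (R * R * R * R) :=
  pos4 `&` [set x | let: (x1, x2, x3, x4) := x in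
    x4 = x1 /\
    x1 ^+ r * x2 * x3 = x1 ^+ (2 * r) + (x2 ^+ r + x3 ^+ r) ^+ r].

Definition C11 r : set (R * R * R * R) :=
  pos4 `&` [set x | let: (x1, x2, x3, x4) := x in
    x3 = x2 /\ x1 * x4 = 2 * x2 ^+ r].

Definition Ja r z : R :=
  let: (z1, z2, _, _) := z in
  (ln z1) ^+ 2 - r%:R * ln z1 * ln z2 + (ln z2) ^+ 2 - ln 2 * ln (z1 * z2).

Definition La r x : set (R * R * R * R) :=
  C11 r `&` [set z | Ja r z = Ja r x].

Definition l_ r z : R :=
  let: (z1, z2, z3, z4) := z in
  (z1 ^+ r * z4 ^+ r + (z2 ^+ r + z3 ^+ r) ^+ r) ^+ r /
  (z1 ^+ (r ^ 2 - 2) * z2 ^+ r * z3 ^+ r * z4 ^+ (r ^ 2 - 2)).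

Definition Jb r z : R :=
  let: (z1, _, _, z4) := z in
  (ln (z1 * z4)) ^+ 2 - r%:R ^+ 2 * ln z1 * ln z4
  - ln (l_ r z) * ln (z1 * z4).

Definition Lb r y : set (R * R * R * R) :=
  pos4 `&` [set z | pi_ r z = pi_ r y /\ Jb r z = Jb r y].

Definition orbit_cvg_to (f : R * R * R * R -> R * R * R * R) x y : Prop :=
  iter n f x @[n --> \oo] --> y.

Definition orbit_cvg_to_pinfty (f : R * R * R * R -> R * R * R * R) x : Prop :=
  [/\ (iter n f x).1.1.1 @[n --> \oo] --> +oo,
      (iter n f x).1.1.2 @[n --> \oo] --> +oo,
      (iter n f x).1.2 @[n --> \oo] --> +oo
    & (iter n f x).2 @[n --> \oo] --> +oo].

Definition orbit_cvg_to_4periodic_orbit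
    (f : R * R * R * R -> R * R * R * R) x : Prop :=
  exists y, [/\ pos4 y, has_minimal_period f 4 y
    & forall i : nat, (i < 4)%N ->
        iter (4 * n + i) f x @[n --> \oo] --> iter i f y].

End Maps.

Arguments F_ R r : clear implicits.
Arguments V_ R r : clear implicits.
Arguments C11 R r : clear implicits.

(* Main.v *)
(** In logarithms, [phi] is conjugate to a linear map.  If (U, V) = log pi(x),
    then pi o phi turns (U, V) into (V, -U), a rotation of order 4, so that the
    dynamics takes place in four fibres of pi.  On a fibre x is determined by
    (log x_2, log x_4), and y_n = log x_2 along the orbit satisfies
    y_{n+2} - r y_{n+1} + y_n = log (1 + e^{r V_n}), with a 4-periodic right-hand
    side.  Subtracting the unique 4-periodic solution leaves a linear recurrence
    with characteristic roots lam > 1 and 1/lam, where lam + 1/lam = r.  Hence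
    pos4 has coordinates (U, V, alpha, beta) in which phi is
    (V, -U, lam alpha, beta / lam): the set V is alpha = beta = 0, C_(1,1) is
    U = V = 0, the invariants J_a and J_b are affine functions of alpha * beta on
    each fibre, and the sign of alpha decides the behaviour of the orbit. *)
Require Import Defs.
From mathcomp Require Import all_boot all_order all_algebra.
From mathcomp Require Import all_classical all_reals all_analysis.
From mathcomp Require Import ring lra.
Set Implicit Arguments.
Unset Strict Implicit.
Unset Printing Implicit Defensive.
Import Order.TTheory GRing.Theory Num.Theory.
Import numFieldNormedType.Exports.
Local Open Scope classical_set_scope.
Local Open Scope ring_scope.

(** * Characteristic root and limits of real sequences *)

(** [lam] is the larger root of X^2 - t X + 1, whose two roots have product 1. *)
Lemma invsum_root (R : rcfType) (t : R) : 2 < t ->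
  exists lam : R, 1 < lam /\ t = lam + lam^-1.
Proof.
move=> t2; pose s := Num.sqrt (t ^+ 2 - 4); pose lam := (t + s) / 2.
have s0 : 0 <= s by rewrite sqrtr_ge0.
have s2 : s ^+ 2 = t ^+ 2 - 4 by rewrite sqr_sqrtr//; nra.
have lam1 : 1 < lam by rewrite /lam; lra.
have lam0 : lam != 0 by rewrite gt_eqF// (lt_trans _ lam1).
exists lam; split=> //; apply: (mulIf lam0).
by rewrite mulrDl mulVf// /lam; nra.
Qed.

(** The largest of the four thresholds serves all residues at once. Since [l] is arbitrary, this
    covers limits at a point and at infinity alike. *)
Lemma cvg_mod4 (T : Type) (u : nat -> T) (l : set_system T) :
  (forall i, (i < 4)%N -> u (4 * n + i)%N @[n --> \oo] --> l) -> u @ \oo --> l.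
Proof.
move=> ul A lA.
have [N HN] : exists N, forall i n, (i < 4)%N -> (N <= n)%N -> A (u (4 * n + i)%N).
  have [N0 _ H0] := ul 0%N isT A lA; have [N1 _ H1] := ul 1%N isT A lA.
  have [N2 _ H2] := ul 2%N isT A lA; have [N3 _ H3] := ul 3%N isT A lA.
  exists (maxn (maxn N0 N1) (maxn N2 N3)) => i n.
  rewrite !geq_max => i4 /andP[/andP[n0 n1] /andP[n2 n3]].
  by case: i i4 => [|[|[|[|//]]]] _; [exact: H0|exact: H1|exact: H2|exact: H3].
exists (4 * N)%N => // n /= Nn.
rewrite /= (divn_eq n 4) mulnC; apply: HN; first by rewrite ltn_mod.
by rewrite leq_divRL// mulnC.
Qed.

Lemma cvg_4nD (T : Type) (u : nat -> T) (l : set_system T) i :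
  u @ \oo --> l -> u (4 * n + i)%N @[n --> \oo] --> l.
Proof.
move=> ul A /ul[N _ HN]; exists N => // n /= Nn; apply: HN => /=.
by rewrite (leq_trans Nn)// (leq_trans _ (leq_addr _ _))// leq_pmull.
Qed.

Lemma cvg_quad (T : topologicalType) (u v w t : nat -> T) (a b c d : T) :
  u n @[n --> \oo] --> a -> v n @[n --> \oo] --> b ->
  w n @[n --> \oo] --> c -> t n @[n --> \oo] --> d ->
  (u n, v n, w n, t n) @[n --> \oo] --> (a, b, c, d).
Proof.
by move=> ua vb wc td; exact: (cvg_pair (cvg_pair (cvg_pair ua vb) wc) td).
Qed.

Lemma cvg_expR_pinfty (R : realType) (u : nat -> R) :
  u n @[n --> \oo] --> +oo -> expR (u n) @[n --> \oo] --> +oo.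
Proof.
move=> /cvgryPge uoo; apply/cvgryPge => A; near=> n.
rewrite (le_trans _ (expR_ge1Dx _))//.
have : A <= u n by near: n; exact: uoo.
by move=> /le_trans; apply; rewrite lerDr.
Unshelve. all: by end_near. Qed.

Lemma cvg_expR_ninfty (R : realType) (u : nat -> R) :
  - u n @[n --> \oo] --> +oo -> expR (u n) @[n --> \oo] --> 0.
Proof.
move=> uoo; under eq_fun do rewrite -[u _]opprK.
exact: (cvg_comp _ _ uoo (@cvgr_expR R)).
Qed.

Lemma cvg_expn_pinfty (R : realType) (z : R) :
  1 < z -> z ^+ n @[n --> \oo] --> +oo.
Proof.
move=> z1; have z0 : 0 < z by rewrite (lt_trans _ z1).
have : (z^-1) ^+ n @[n --> \oo] --> (0 : R).
  by apply: cvg_expr; rewrite gtr0_norm ?invr_gt0// invf_lt1.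
under eq_fun do rewrite exprVn.
by move/(gtr0_cvgV0 _).1; apply; near=> n; rewrite exprn_gt0.
Unshelve. all: by end_near. Qed.

Lemma cvg_mulD_pinfty (R : realType) (k l : R) (u v : nat -> R) : 0 < k ->
  u n @[n --> \oo] --> +oo -> v n @[n --> \oo] --> l ->
  k * u n + v n @[n --> \oo] --> +oo.
Proof.
move=> k0 /cvgryPge uoo vl; apply/cvgryPge => A; near=> n.
have : (A - l + 1) / k <= u n by near: n; exact: uoo.
rewrite ler_pdivrMr// mulrC => h1.
have : l - 1 <= v n by near: n; apply: (cvgr_ge l vl); rewrite ltrBlDr ltrDl.
by move=> h2; lra.
Unshelve. all: by end_near. Qed.

(** * Logarithmic coordinates in which [phi] is linear *)

Section Chart.
Variables (R : realType) (r : nat) (lam : R).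
Hypothesis lam_gt1 : 1 < lam.
Hypothesis lam_sum : r%:R = lam + lam^-1.
Implicit Types (p : R * R) (c a b al be : R).

Local Notation mu := lam^-1.

Let lam_gt0 : 0 < lam. Proof. exact: lt_trans lam_gt1. Qed.
Let mu_gt0 : 0 < mu. Proof. by rewrite invr_gt0. Qed.
Let mu_lt1 : mu < 1. Proof. by rewrite invf_lt1. Qed.
Let lam_mu : lam * mu = 1. Proof. by rewrite mulfV ?gt_eqF. Qed.
Let lam_mu_gt0 : 0 < lam - mu.
Proof. by rewrite subr_gt0 (lt_trans mu_lt1). Qed.
Let r2 : (2 : R) < r%:R.
Proof. by rewrite lam_sum; move: (mu) lam_mu lam_mu_gt0 mu_gt0 => m; nra. Qed.

Definition rot p : R * R := (p.2, - p.1).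

(** With c = log (x_3 / x_2), this is log (x_2^r + x_3^r) - r log x_2. *)
Definition logD1exp c : R := ln (1 + expR (r%:R * c)).

Local Notation g := logD1exp.

Lemma logD1expN c : g (- c) = g c - r%:R * c.
Proof.
rewrite /logD1exp mulrN -[X in _ - X]expRK -lnV ?posrE ?expR_gt0//.
rewrite -lnM ?posrE ?invr_gt0 ?addr_gt0 ?expR_gt0//.
by rewrite mulrDl mul1r divff ?gt_eqF ?expR_gt0// expRN addrC.
Qed.

Lemma expR_logD1exp c : expR (g c) = 1 + expR (r%:R * c).
Proof. by rewrite lnK// posrE addr_gt0 ?expR_gt0. Qed.

(* [base] is the unique solution, as a function of [p], of the two equations
   [base_rot] and [base_rotV]: these are the logarithms of the equations of [V]
   restricted to a fibre of [pi_]. *)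
Definition base p : R :=
  (2 * (g p.2 - p.1) + r%:R * (g p.1 - p.2)) / (4 - r%:R ^+ 2).

Let den0 : 4 - r%:R ^+ 2 != 0 :> R.
Proof.
by rewrite lt_eqF//; have := r2; nra.
Qed.

Lemma base_rot p : r%:R * base (rot p) = 2 * base p - g p.2 + p.1.
Proof. by rewrite /base /= logD1expN; field. Qed.

Lemma base_rotV p : r%:R * base p = 2 * base (rot p) - g p.1 + p.2.
Proof. by rewrite /base /= logD1expN; field. Qed.

Lemma base_rot2 p : base (rot (rot p)) = base p + p.1.
Proof. by rewrite /base /= !logD1expN; field. Qed.

Definition expaff c a b al be : R := expR (c + a * al + b * be).

(** With y_n = log x_2 along the orbit, the second and fourth logarithms are y_0 and y_1. The first
    is y_{-1} plus the preceding value of log (x_3 / x_2), which turns its base value into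
    [base (rot p)], by [base_rot2]. *)
Definition chart p al be : R * R * R * R :=
  (expaff (base (rot p)) mu lam al be,
   expaff (base p) 1 1 al be,
   expaff (base p + p.1) 1 1 al be,
   expaff (base (rot p)) lam mu al be).

Lemma chart_pos4 p al be : pos4 (chart p al be).
Proof. by split; exact: expR_gt0. Qed.

(* The identity [x_2^r + x_3^r = v x_1 x_4] in logarithms, where [v] is the
   second component of [pi_]. *)
Let exch p al be : r%:R * (base p + 1 * al + 1 * be) + g p.1 =
  (base (rot p) + mu * al + lam * be) + (base (rot p) + lam * al + mu * be)
   + p.2.
Proof. by rewrite !mulrDr base_rotV lam_sum; ring. Qed.

Let sumX c d : expR c ^+ r + expR (c + d) ^+ r = expR (r%:R * c + g d).
Proof.
rewrite -!expRM_natl [expR (_ + g d)]expRD expR_logD1exp [in RHS]mulrDr mulr1.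
by rewrite -expRD -mulrDr.
Qed.

Let sum23 p al be : expaff (base p) 1 1 al be ^+ r
    + expaff (base p + p.1) 1 1 al be ^+ r =
  expaff (base (rot p)) mu lam al be * expaff (base (rot p)) lam mu al be
   * expR p.2.
Proof.
rewrite /expaff -!expRD -exch -sumX.
by congr (_ + expR _ ^+ r); ring.
Qed.

(** This is the numerator of the last component of [phi]; it recurs in [V_] and [l_]. *)
Let sum14 p al be :
  expaff (base (rot p)) mu lam al be ^+ r
    * expaff (base (rot p)) lam mu al be ^+ r
  + (expaff (base (rot p)) mu lam al be * expaff (base (rot p)) lam mu al be
     * expR p.2) ^+ r =
  expR (r%:R * (2 * base (rot p) + (mu + lam) * (al + be)) + g p.2).
Proof.
set A := expaff _ mu _ _ _; set D := expaff _ lam _ _ _.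
have -> : A ^+ r * D ^+ r + (A * D * expR p.2) ^+ r =
    (A * D) ^+ r * (1 + expR p.2 ^+ r) by rewrite mulrDr mulr1 !exprMn.
rewrite /A /D /expaff -expRD -!expRM_natl -expR_logD1exp -expRD.
by congr expR; ring.
Qed.

Lemma pi_chart p al be : pi_ r (chart p al be) = (expR p.1, expR p.2).
Proof.
rewrite /= sum23; congr pair.
  by rewrite /expaff -expRN -expRD; congr expR; ring.
by rewrite mulrC mulKf// gt_eqF// mulr_gt0 ?expR_gt0.
Qed.

Lemma phi_chart p al be :
  phi r (chart p al be) = chart (rot p) (lam * al) (mu * be).
Proof.
rewrite /phi {1}/chart sum23 /chart base_rot2; congr (_, _, _, _).
- rewrite /expaff.
  by rewrite !mulrA (mulrC mu) lam_mu.
- by rewrite /expaff !mul1r.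
- by rewrite /expaff -expRN -!expRD; congr expR => /=; ring.
- rewrite sum14 /expaff -expRM_natl -expRD -expRN -expRD; congr expR.
  (* The constant terms match by [base_rot], the others because [lam] and its inverse are roots of
     X^2 - r X + 1. *)
  have e1 := base_rot p.
  have lamE : r%:R * lam = lam ^+ 2 + 1 by rewrite lam_sum mulrDl mulVf ?gt_eqF.
  have muE : r%:R * mu = mu ^+ 2 + 1.
    by rewrite lam_sum mulrDl lam_mu addrC.
  have := congr1 ( *%R^~ al) lamE; have := congr1 ( *%R^~ be) muE => /=.
  by lra.
Qed.

Lemma iter_phi_chart n p al be : iter n (phi r) (chart p al be) =
  chart (iter n rot p) (lam ^+ n * al) (mu ^+ n * be).
Proof.
elim: n => [|n IHn] /=; first by rewrite !expr0 !mul1r.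
by rewrite IHn phi_chart !mulrA -!exprS.
Qed.

(** [pi_] recovers [p]; then x_2 and x_4 give al + be and lam al + mu be, a linear system of
    determinant mu - lam, which is nonzero. *)
Lemma chart_inj p al be q al' be' : chart p al be = chart q al' be' ->
  [/\ p = q, al = al' & be = be'].
Proof.
move=> h; have := congr1 (pi_ r) h.
rewrite !pi_chart => -[/expR_inj p1 /expR_inj p2].
have {p1 p2} pq : p = q by move: p q p1 p2 {h} => [p1 p2] [q1 q2] /= -> ->.
move: h; rewrite pq => -[_ /expR_inj h1 _ /expR_inj h2].
have h3 : al + be = al' + be' by lra.
have h4 : (lam - mu) * (al - al') = 0 by nra.
move/eqP: h4; rewrite mulf_eq0 gt_eqF//= subr_eq0 => /eqP h4.
by split => //; lra.
Qed.

Lemma chart_surj x : pos4 x -> exists p al be, x = chart p al be.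
Proof.
case: x => [[[x1 x2] x3] x4] [h1 h2 h3 h4].
pose p := (ln x3 - ln x2, ln (x2 ^+ r + x3 ^+ r) - ln x1 - ln x4).
pose z := ln x2 - base p; pose w := ln x4 - base (rot p).
(* Cramer's solution of al + be = z, lam al + mu be = w. *)
pose al := (w - mu * z) / (lam - mu); pose be := (lam * z - w) / (lam - mu).
have d0 : lam - mu != 0 by rewrite gt_eqF.
have zE : al + be = z by rewrite /al /be -mulrDl; apply: (canLR (mulfK d0)); ring.
have wE : lam * al + mu * be = w.
  rewrite /al /be !mulrA -mulrDl; apply: (canLR (mulfK d0)); ring.
have E2 : base p + 1 * al + 1 * be = ln x2 by rewrite !mul1r -addrA zE /z; ring.
have E4 : base (rot p) + lam * al + mu * be = ln x4 by rewrite -addrA wE /w; ring.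
exists p, al, be; rewrite /chart /expaff E2 E4 !lnK ?posrE//.
have -> : base p + p.1 + 1 * al + 1 * be = ln x3.
  by move: E2 => /(congr1 (+%R^~ p.1)); rewrite [in RHS]/p/=; lra.
rewrite lnK ?posrE//; congr (_, _, _, _).
(* The remaining coordinate x_1 is forced by the second component of [pi_], through [exch]. *)
rewrite -[LHS]lnK ?posrE//; congr expR.
have p1E : ln x3 = ln x2 + p.1 by rewrite /p/=; ring.
have p2E : p.2 = r%:R * ln x2 + g p.1 - ln x1 - ln x4.
  rewrite [LHS]/= -{1}(lnK h2) -{1}(lnK h3) p1E sumX expRK//.
by have := exch p al be; rewrite E2 E4; lra.
Qed.

(** * Special sets, fixed point and invariants in the chart *)

(** x_4 = x_1 forces al = be; by [base_rot] the second equation then reduces to (4 - r^2) al = 0. *)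
Lemma V_chart p al be : V_ R r (chart p al be) <-> al = 0 /\ be = 0.
Proof.
have -> : V_ R r (chart p al be) <->
    base (rot p) + mu * al + lam * be = base (rot p) + lam * al + mu * be /\
    r%:R * (base (rot p) + mu * al + lam * be) + (base p + 1 * al + 1 * be)
     + (base p + p.1 + 1 * al + 1 * be) =
    r%:R * (2 * base (rot p) + (mu + lam) * (al + be)) + g p.2.
  rewrite /V_ /=; set A := expaff _ mu _ _ _; set D := expaff _ lam _ _ _.
  have sE : D = A -> A ^+ (2 * r) = A ^+ r * D ^+ r by move=> ->; rewrite mul2n -addnn exprD.
  split.
    move=> [_ [DA]]; rewrite sE// sum23 sum14.
    rewrite /A /expaff -expRM_natl -!expRD => /expR_inj <-; split=> //.
    by move: DA => /expR_inj ->.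
  move=> [AD h]; have DA : D = A by rewrite /D /A /expaff AD.
  split; first exact: chart_pos4.
  split => //; rewrite sE// sum23 sum14 -h.
  by rewrite /A /expaff -expRM_natl -!expRD.
have e1 := base_rot p; have e2 := lam_sum.
split=> [[h1 h2]|[-> ->]]; last by rewrite !mulr0; split; lra.
have : (lam - mu) * (al - be) = 0 by nra.
move/eqP; rewrite mulf_eq0 gt_eqF//= subr_eq0 => /eqP ab.
have : (4 - r%:R ^+ 2) * al = 0 by move: h2; rewrite -ab e2; nra.
by move/eqP; rewrite mulf_eq0 (negbTE den0)/= => /eqP al0; rewrite -ab al0.
Qed.

(** x_3 = x_2 means p.1 = 0; by [exch] the other equation then says g 0 - p.2 = ln 2, where g 0 = ln
    2. *)
Lemma C11_chart p al be : C11 R r (chart p al be) <-> p = (0, 0).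
Proof.
have g0 : g 0 = ln 2 by rewrite /logD1exp mulr0 expR0.
rewrite /C11 /=.
have -> : expaff (base (rot p)) mu lam al be * expaff (base (rot p)) lam mu al be
    = expR (r%:R * (base p + 1 * al + 1 * be) + g p.1 - p.2).
  by rewrite /expaff -expRD exch; congr expR; ring.
have -> : 2 * expaff (base p) 1 1 al be ^+ r =
    expR (r%:R * (base p + 1 * al + 1 * be) + ln 2).
  by rewrite /expaff -expRM_natl [RHS]expRD lnK ?posrE// mulrC.
split=> [[_ [/expR_inj h1 /expR_inj h2]]|->/=].
  have p1 : p.1 = 0 by lra.
  rewrite p1 g0 in h2; have p2 : p.2 = 0 by lra.
  by rewrite [LHS]surjective_pairing p1 p2.
split; first exact: chart_pos4.
by rewrite g0 addr0 subr0.
Qed.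

Lemma chart0 : chart (0, 0) 0 0 = F_ R r.
Proof.
have d0 : 2 - r%:R != 0 :> R by rewrite lt_eqF// subr_lt0.
rewrite /chart /expaff /F_ /rot /= oppr0 /base /= /logD1exp !mulr0 !addr0 expR0.
rewrite !subr0 -mulrDl.
have -> : (2 + r%:R) * ln (1 + 1) / (4 - r%:R ^+ 2) = (2 - r%:R)^-1 * ln 2 :> R.
  rewrite -[1 + 1]/(2 : R); field.
  by rewrite d0 den0.
by rewrite /powR pnatr_eq0.
Qed.

(** The linear terms cancel around the fixed point. The form u^2 - r u v + v^2 vanishes on both
    eigendirections, so only al be survives, with coefficient 4 - r^2 = -(lam - mu)^2. *)
Lemma Ja_chart al be : Ja r (chart (0, 0) al be) =
  (2 - r%:R) * base (0, 0) ^+ 2 - 2 * ln 2 * base (0, 0)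
  - (lam - mu) ^+ 2 * (al * be).
Proof.
rewrite /Ja/= lnM ?posrE ?expR_gt0// /expaff !expRK.
have -> : rot (0, 0) = (0, 0) by rewrite /rot /= oppr0.
have : r%:R * base (0, 0) = 2 * base (0, 0) - ln 2.
  have := base_rotV (0, 0).
  by rewrite /rot /= oppr0 /logD1exp mulr0 expR0 addr0.
move=> h.
have -> : ln 2 = (2 - r%:R) * base (0, 0) :> R by rewrite mulrBl h; ring.
rewrite lam_sum; field.
by rewrite gt_eqF.
Qed.

(** log l is constant on each fibre of [pi_], with the value that cancels the linear terms around
    [base (rot p)]. *)
Lemma Jb_chart p al be : Jb r (chart p al be) =
  (r%:R ^+ 2 - 4) * base (rot p) ^+ 2
  - r%:R ^+ 2 * (lam - mu) ^+ 2 * (al * be).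
Proof.
have nr2 : (2 < r)%N by rewrite -(ltr_nat R).
have ln_l : ln (l_ r (chart p al be)) = (4 - r%:R ^+ 2) * base (rot p).
  rewrite /l_ {1}/chart sum23 sum14 /expaff -!expRM_natl -!expRD -expRN -expRD.
  (* The exponent r ^ 2 - 2 is a truncated subtraction, so 2 <= r ^ 2 has to be checked. *)
  rewrite expRK natrB; last by rewrite (leq_trans (ltnW nr2))// -mulnn leq_pmulr// ltnW// ltnW.
  have -> : g p.2 = 2 * base p - r%:R * base (rot p) + p.1.
    by rewrite base_rot; ring.
  by rewrite natrX lam_sum; ring.
rewrite {1}/Jb {1}/chart ln_l lnM ?posrE ?expR_gt0// /expaff !expRK.
rewrite lam_sum; field.
by rewrite gt_eqF.
Qed.

(** * Asymptotics and periods of orbits *)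

Lemma iter_rot_4nD n i p : iter (4 * n + i) rot p = iter i rot p.
Proof.
have rot4 q : iter 4 rot q = q by case: q => q1 q2; rewrite /= /rot /= !opprK.
by elim: n => // n IHn; rewrite mulnS -addnA iterD rot4.
Qed.

(** A turn by one, two or three quarters fixes only the origin. *)
Lemma iter_rot_neq i j p : (i < 4)%N -> (j < 4)%N -> i <> j -> p <> (0, 0) ->
  iter i rot p <> iter j rot p.
Proof.
case: p => p1 p2 i4 j4 ij pn0 h; apply: pn0; move: h.
by move: i j i4 j4 ij => [|[|[|[|//]]]] [|[|[|[|//]]]] _ _ //= _;
  rewrite /rot /= => -[h1 h2]; congr pair; lra.
Qed.

Let cvg_stable c i : mu ^+ (4 * n + i) * c @[n --> \oo] --> 0.
Proof.
rewrite -[X in _ --> X](mul0r c); apply: cvgMl.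
apply: (@cvg_4nD _ (fun n => mu ^+ n)); apply: cvg_expr.
by rewrite gtr0_norm.
Qed.

Let cvg_unstable i : lam ^+ (4 * n + i) @[n --> \oo] --> +oo.
Proof. exact/(@cvg_4nD _ (fun n => lam ^+ n))/cvg_expn_pinfty. Qed.

(** The growing mode dominates, as the other one tends to 0. All four components of [chart] have a
    positive coefficient [a], hence share the same fate. *)
Lemma cvg_expaff_pinfty c a b al be i : 0 < a -> 0 < al ->
  expaff c a b (lam ^+ (4 * n + i) * al) (mu ^+ (4 * n + i) * be)
    @[n --> \oo] --> +oo.
Proof.
move=> a0 al0; apply: cvg_expR_pinfty.
rewrite (_ : (fun n => _) = fun n => a * al * lam ^+ (4 * n + i)
    + (mu ^+ (4 * n + i) * (be * b) + c)); last by apply/funext => n; ring.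
apply: cvg_mulD_pinfty => //; first exact: mulr_gt0.
by apply: cvgD; [exact: cvg_stable|exact: cvg_cst].
Qed.

Lemma cvg_expaff_0 c a b al be i : 0 < a -> al < 0 ->
  expaff c a b (lam ^+ (4 * n + i) * al) (mu ^+ (4 * n + i) * be)
    @[n --> \oo] --> 0.
Proof.
move=> a0 al0; apply: cvg_expR_ninfty.
rewrite (_ : (fun n => _) = fun n => a * (- al) * lam ^+ (4 * n + i)
    + (mu ^+ (4 * n + i) * (- be * b) + - c)); last by apply/funext => n; ring.
apply: cvg_mulD_pinfty => //; first by rewrite mulr_gt0 ?oppr_gt0.
by apply: cvgD; [exact: cvg_stable|exact: cvg_cst].
Qed.

Lemma cvg_expaff_stable c a b be i :
  expaff c a b 0 (mu ^+ (4 * n + i) * be) @[n --> \oo] --> expaff c a b 0 0.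
Proof.
have h : c + a * 0 + b * (mu ^+ (4 * n + i) * be) @[n --> \oo]
    --> c + a * 0 + b * 0.
  by apply: cvgD; [exact: cvg_cst|apply: cvgMr; exact: cvg_stable].
exact: (cvg_comp _ _ h (@continuous_expR R _)).
Qed.

Lemma iter_4nD_phi_chart n i p al be :
  iter (4 * n + i) (phi r) (chart p al be) =
  chart (iter i rot p) (lam ^+ (4 * n + i) * al) (mu ^+ (4 * n + i) * be).
Proof. by rewrite iter_phi_chart iter_rot_4nD. Qed.

Lemma orbit_chart_pinfty p al be : 0 < al ->
  orbit_cvg_to_pinfty (phi r) (chart p al be).
Proof.
move=> al0; split; apply: cvg_mod4 => i _;
  under eq_fun do rewrite iter_4nD_phi_chart; exact: cvg_expaff_pinfty.
Qed.

Lemma orbit_chart_0 p al be : al < 0 ->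
  orbit_cvg_to (phi r) (chart p al be) (0, 0, 0, 0).
Proof.
move=> al0; apply: cvg_mod4 => i _; under eq_fun do rewrite iter_4nD_phi_chart.
by apply: cvg_quad; exact: cvg_expaff_0.
Qed.

Lemma orbit_chart_stable p be i :
  iter (4 * n + i) (phi r) (chart p 0 be) @[n --> \oo]
    --> chart (iter i rot p) 0 0.
Proof.
under eq_fun do rewrite iter_4nD_phi_chart mulr0.
by apply: cvg_quad; exact: cvg_expaff_stable.
Qed.

Lemma period4_chart p : p <> (0, 0) ->
  has_minimal_period (phi r) 4 (chart p 0 0).
Proof.
move=> p0; split=> //.
  have rot4 : iter 4 rot p = p := iter_rot_4nD 1 0 p.
  by rewrite iter_phi_chart rot4 !mulr0.
move=> k /andP[k1 k4]; rewrite iter_phi_chart => /chart_inj[h _ _].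
have k0 : k <> 0%N by move=> k0; rewrite k0 in k1.
exact: (@iter_rot_neq k 0 p k4 isT k0 p0 h).
Qed.

(** t^m c = c with t > 0, t <> 1 and m >= 1 forces c = 0; this applies to both eigenvalues. *)
Lemma periodic_chart p al be : periodic_pt (phi r) (chart p al be) ->
  al = 0 /\ be = 0.
Proof.
move=> [m [m1 + _]]; rewrite iter_phi_chart => /chart_inj[_ h1 h2].
have fix0 (t c : R) : 0 < t -> t != 1 -> t ^+ m * c = c -> c = 0.
  move=> t0 t1 /eqP; rewrite -subr_eq0 -[X in _ - X]mul1r -mulrBl mulf_eq0.
  by rewrite subr_eq0 pexprn_eq1 ?ltW// (negbTE t1) orbF -leqn0 leqNgt m1 => /eqP.
split; first exact: (fix0 lam _ lam_gt0 (negbT (gt_eqF lam_gt1))).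
exact: (fix0 mu _ mu_gt0 (negbT (lt_eqF mu_lt1))).
Qed.

End Chart.

(** * Classification of the orbits, read off in the chart *)

Theorem theorem4 (R : realType) (r : nat) (hr : (2 < r)%N) :
  [/\ [set x : R * R * R * R | pos4 x /\ phi r x = x] = [set F_ R r],
      forall x : R * R * R * R, (V_ R r `\` [set F_ R r]) x ->
        has_minimal_period (phi r) 4 x,
      forward_invariant (phi r) (C11 R r)
    & forall x : R * R * R * R, (@pos4 R `\` V_ R r) x ->
      [/\ ~ periodic_pt (phi r) x,
          C11 R r x ->
            (forall n : nat, La r x (iter n (phi r) x)) /\
            [\/ orbit_cvg_to (phi r) x (F_ R r),
                orbit_cvg_to (phi r) x (0, 0, 0, 0)
              | orbit_cvg_to_pinfty (phi r) x]
        & ~ C11 R r x ->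
            [/\ forall i j : nat, (i < 4)%N -> (j < 4)%N -> i <> j ->
                  Lb r (iter i (phi r) x) `&` Lb r (iter j (phi r) x) = set0,
                forall n i : nat, (i < 4)%N ->
                  Lb r (iter i (phi r) x) (iter (4 * n + i) (phi r) x)
              & [\/ orbit_cvg_to_4periodic_orbit (phi r) x,
                    orbit_cvg_to (phi r) x (0, 0, 0, 0)
                  | orbit_cvg_to_pinfty (phi r) x]]]].
Proof.
have [lam [lam1 lamE]] : exists lam : R, 1 < lam /\ r%:R = lam + lam^-1.
  by apply: invsum_root; rewrite ltr_nat.
have lam0 : lam != 0 by rewrite gt_eqF// (lt_trans _ lam1).
(* The product al be is conserved, hence so are [Ja] on [C11] and [Jb] on each fibre. *)
have expK n (a b : R) : lam ^+ n * a * (lam^-1 ^+ n * b) = a * b.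
  by rewrite mulrACA -exprMn mulfV// expr1n mul1r.
have rot00 : rot (0, 0) = (0, 0) :> R * R by rewrite /rot /= oppr0.
have rot0 n : iter n (@rot R) (0, 0) = (0, 0) by elim: n => //= n ->.
have phi_ := phi_chart lam1 lamE; have iter_ := iter_phi_chart lam1 lamE.
split.
- apply/seteqP; split=> [x [/(chart_surj lam1 lamE)[p [al [be ->]]] h]|x ->].
    (* A fixed point has minimal period 1, so both modes vanish; then rot p = p leaves only the
       origin. *)
    have [al0 be0] : al = 0 /\ be = 0.
      apply: (periodic_chart lam1 lamE); exists 1%N; split; [by []|exact: h|].
      by move=> k /andP[k1]; rewrite ltnNge k1.
    move: h; rewrite phi_ => /(chart_inj lam1 lamE)[h _ _].
    have p0 : p = (0, 0).
      by case: p h => p1 p2; rewrite /rot /= => -[h1 h2]; congr pair; lra.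
    by rewrite al0 be0 p0 (chart0 lam1 lamE).
  rewrite -(chart0 lam1 lamE); split; first exact: chart_pos4.
  by rewrite phi_ !mulr0 rot00.
- move=> x [xV xF]; have [px _] := xV.
  have [p [al [be xE]]] := chart_surj lam1 lamE px.
  move: xV xF; rewrite xE => /(V_chart lam1 lamE)[-> ->] xF.
  apply: (period4_chart lam1 lamE) => p0; apply: xF => /=.
  by rewrite p0 (chart0 lam1 lamE).
- move=> _ [x xC <-]; have [px _] := xC.
  have [p [al [be xE]]] := chart_surj lam1 lamE px.
  move: xC; rewrite xE phi_ => /(C11_chart lam1 lamE) ->.
  exact/(C11_chart lam1 lamE)/rot00.
move=> x [/(chart_surj lam1 lamE)[p [al [be ->]]] xV]; split.
- by move=> /(periodic_chart lam1 lamE) ?; exact/xV/(V_chart lam1 lamE).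
- move=> /(C11_chart lam1 lamE) p0; split=> [n|].
    rewrite iter_ p0 rot0; split; first exact/(C11_chart lam1 lamE).
    by rewrite /mkset !(Ja_chart lam1 lamE) expK.
  case: (ltgtP al 0) => al0.
  + by apply: Or32; exact: orbit_chart_0.
  + by apply: Or33; exact: orbit_chart_pinfty.
  + apply: Or31; rewrite al0 -(chart0 lam1 lamE) p0.
    apply: cvg_mod4 => i _; rewrite -[in X in _ --> X](rot0 i).
    exact: orbit_chart_stable.
move=> xC; have p0 : p <> (0, 0) by move=> ?; exact/xC/(C11_chart lam1 lamE).
split.
- move=> i j i4 j4 ij; apply/seteqP; split=> // z /=.
  rewrite !iter_ => -[[_ [+ _]] [_ [+ _]]].
  rewrite !(pi_chart lam1 lamE) => -> -[/expR_inj h1 /expR_inj h2].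
  apply: (iter_rot_neq i4 j4 ij p0).
  by rewrite [LHS]surjective_pairing h1 h2 -surjective_pairing.
- move=> n i i4; rewrite !iter_ iter_rot_4nD; split; first exact: chart_pos4.
  by rewrite /mkset !(pi_chart lam1 lamE) !(Jb_chart lam1 lamE) !expK.
case: (ltgtP al 0) => al0.
+ by apply: Or32; exact: orbit_chart_0.
+ by apply: Or33; exact: orbit_chart_pinfty.
(* The limit orbit is that of the point of [V_] in the same fibre of [pi_]. *)
+ apply: Or31; rewrite al0; exists (chart r lam p 0 0); split.
  * exact: chart_pos4.
  * exact: period4_chart.
  * by move=> i i4; rewrite iter_ !mulr0; exact: orbit_chart_stable.
Qed.
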